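(* Let $G_1$ and $G_2$ be graphs with $V(G_1)\cap V(G_2)=\{c\}$. Let $G$ be the one-sum of $G_1$ and $G_2$, i.e. the graph with vertex set $V(G_1)\cup V(G_2)$ and edge set $E(G_1)\cup E(G_2)$. Then for any $a\in V(G_1)\setminus\{c\}$ and any $b\in V(G_2)\setminus\{c\}$, $$S(G,a,b)\cong S(G_1,a,c)\,\square\,S(G_2,c,b).$$
   Context: Graphs are finite and simple. For a graph $G$ with distinct vertices $a,b$, a shortest $a,b$-path is a path between $a$ and $b$ of length $d_G(a,b)$. The shortest path graph $S(G,a,b)$ is the graph whose vertices are the shortest $a,b$-paths in $G$, two of them being adjacent if and only if the corresponding paths differ in exactly one vertex. The Cartesian product $H_1\,\square\,H_2$ has vertex set $V(H_1)\times V(H_2)$, with $(x_1,x_2)$ adjacent to $(y_1,y_2)$ if and only if either $x_1=y_1$ and $x_2\sim y_2$ in $H_2$, or $x_1\sim y_1$ in $H_1$ and $x_2=y_2$. *)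

(* Defs.v *)
From mathcomp Require Import all_boot.

Set Implicit Arguments.
Unset Strict Implicit.
Unset Printing Implicit Defensive.

(* A graph carries its own vertex set inside an ambient finite type, so that
   V(G1) :&: V(G2) and the union of two graphs have their literal meaning. *)
Record sgraph (T : finType) := SGraph {
  verts : {set T};
  adj : rel T;
  adj_sym : symmetric adj;
  adj_irr : irreflexive adj;
  adj_verts : forall x y, adj x y -> x \in verts
}.

Section Union.
Variables (T : finType) (G1 G2 : sgraph T).

Definition union_adj : rel T := fun x y => adj G1 x y || adj G2 x y.

Fact union_sym : symmetric union_adj.
Proof. by move=> x y; rewrite /union_adj !(adj_sym _ x). Qed.

Fact union_irr : irreflexive union_adj.
Proof. by move=> x; rewrite /union_adj !adj_irr. Qed.

Fact union_verts x y : union_adj x y -> x \in verts G1 :|: verts G2.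
Proof. by rewrite inE => /orP[] /adj_verts ->; rewrite ?orbT. Qed.

Definition graph_union : sgraph T := SGraph union_sym union_irr union_verts.

End Union.

Section CartesianProduct.
Variables (T1 T2 : finType) (H1 : sgraph T1) (H2 : sgraph T2).

Definition cart_verts : {set T1 * T2} := setX (verts H1) (verts H2).

Definition cart_adj : rel (T1 * T2) := fun x y =>
  [&& x \in cart_verts, y \in cart_verts &
      (x.1 == y.1) && adj H2 x.2 y.2 || adj H1 x.1 y.1 && (x.2 == y.2)].

Fact cart_sym : symmetric cart_adj.
Proof.
move=> x y; rewrite /cart_adj andbCA (eq_sym x.1) (eq_sym x.2).
by rewrite (adj_sym _ x.1) (adj_sym _ x.2).
Qed.

Fact cart_irr : irreflexive cart_adj.
Proof. by move=> x; rewrite /cart_adj !adj_irr andbF !andbF. Qed.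

Fact cart_adj_verts x y : cart_adj x y -> x \in cart_verts.
Proof. by case/and3P. Qed.

Definition cartesian_product : sgraph (T1 * T2)%type :=
  SGraph cart_sym cart_irr cart_adj_verts.

End CartesianProduct.

Definition graph_iso (T1 T2 : finType) (G : sgraph T1) (H : sgraph T2) : Prop :=
  exists f : {x | x \in verts G} -> {y | y \in verts H},
    bijective f /\
    forall u v, adj H (val (f u)) (val (f v)) = adj G (val u) (val v).

Section ShortestPaths.
Variables (T : finType) (G : sgraph T).

(* Paths are listed from x to y, both ends included. *)
Definition is_path (x y : T) (s : seq T) : bool :=
  if s is z :: p then
    [&& z == x, z \in verts G, path (adj G) z p, last z p == y & uniq s]
  else false.

Definition path_length (s : seq T) : nat := (size s).-1.

(* A path has length less than #|T|, so #|T| plays the role of infinity: it is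
   the value taken when there is no path from x to y. *)
Definition dist (x y : T) : nat :=
  \big[minn/#|T|]_(s : {bseq #|T| of T} | is_path x y s) path_length s.

Definition shortest_path (x y : T) (s : seq T) : bool :=
  is_path x y s && (path_length s == dist x y).

End ShortestPaths.

(* Number of positions at which two sequences of the same length disagree.
   On two shortest a,b-paths this is also the number of vertices of one that
   are not on the other, since the i-th vertex is at distance i from a. *)
Definition diff_count (T : eqType) (s t : seq T) : nat :=
  count (fun xy => xy.1 != xy.2) (zip s t).

Section ShortestPathGraph.
Variables (T : finType) (G : sgraph T) (a b : T).

(* A path has at most #|T| vertices, so no path is lost in {bseq #|T| of T}. *)
Definition sp_verts : {set {bseq #|T| of T}} :=
  [set s : {bseq #|T| of T} | shortest_path G a b s].

Definition sp_adj : rel {bseq #|T| of T} := fun s t =>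
  [&& s \in sp_verts, t \in sp_verts & diff_count s t == 1].

Fact sp_sym : symmetric sp_adj.
Proof.
move=> s t; rewrite /sp_adj andbCA; congr [&& _, _ & _ == 1].
rewrite /diff_count; elim: (val s) (val t) => [|x p IHp] [|y q] //=.
by rewrite IHp eq_sym.
Qed.

Fact sp_irr : irreflexive sp_adj.
Proof.
move=> s; rewrite /sp_adj; suff -> : diff_count s s = 0 by rewrite !andbF.
by rewrite /diff_count; elim: (val s) => //= x p ->; rewrite eqxx.
Qed.

Fact sp_adj_verts s t : sp_adj s t -> s \in sp_verts.
Proof. by case/and3P. Qed.

Definition shortest_path_graph : sgraph {bseq #|T| of T} :=
  SGraph sp_sym sp_irr sp_adj_verts.

End ShortestPathGraph.

(* Main.v *)
Require Import Defs.
From mathcomp Require Import all_boot all_order.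

(** A path of the one-sum from [a] to [b] must go through the cut vertex [c], and
    only once; cutting it at [c] gives an [a,c]-path of [G1] and a [c,b]-path of
    [G2], and conversely any two such paths concatenate to an [a,b]-path because
    they share only [c].  Lengths add up under concatenation, so a path is
    shortest iff both of its pieces are; numbers of differing positions add up
    too, so they total 1 iff one pair of pieces agrees and the other differs at
    exactly one vertex. *)

Set Implicit Arguments.
Unset Strict Implicit.
Unset Printing Implicit Defensive.

(** The equal sizes matter: [zip] truncates, so a proper prefix would also show no disagreement. *)
Lemma diff_count_eq0 (T : eqType) (s t : seq T) :
  size s = size t -> (diff_count s t == 0) = (s == t).
Proof.
rewrite /diff_count; elim: s t => [|x s IHs] [|y t] //= [/IHs IH].
by rewrite eqseq_cons -IH; case: (eqVneq x y).
Qed.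

Lemma diff_count_cat (T : eqType) (s1 s2 t1 t2 : seq T) :
  size s1 = size t1 ->
  diff_count (s1 ++ s2) (t1 ++ t2) = diff_count s1 t1 + diff_count s2 t2.
Proof. by move=> eq_sz; rewrite /diff_count zip_cat // count_cat. Qed.

(** * Paths, distance and minimality *)

Section Paths.
Variables (T : finType) (G : sgraph T) (x y : T).
Implicit Types s t : seq T.

Lemma path_verts z p : z \in verts G -> path (adj G) z p ->
  {subset z :: p <= verts G}.
Proof.
elim: p z => [|u p IHp] z Vz /=; first by move=> _ v; rewrite inE => /eqP->.
case/andP=> zu up v; rewrite inE => /predU1P[->//|]; apply: IHp => //.
by apply: (@adj_verts _ G u z); rewrite adj_sym.
Qed.

Lemma is_pathP s : reflect (exists2 p, s = x :: p &
    [/\ x \in verts G, path (adj G) x p, last x p = y & uniq (x :: p)])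
  (is_path G x y s).
Proof.
case: s => [|z p] /=; first by constructor; case.
apply: (iffP and5P) => [[/eqP-> Vx xp /eqP lp up]|[q [-> ->] [Vx xp -> up]]].
  by exists p.
by rewrite eqxx.
Qed.

Lemma is_path_size s : is_path G x y s -> 0 < size s <= #|T|.
Proof.
by case/is_pathP=> p -> [_ _ _ /card_uniqP up]; apply/andP; split; rewrite // -up max_card.
Qed.

Lemma dist_le s : is_path G x y s -> dist G x y <= path_length s.
Proof.
move=> Ps; have [_ szs] := andP (is_path_size Ps).
rewrite /dist -minEnat; pose t : {bseq #|T| of T} := Bseq szs.
pose len (u : {bseq #|T| of T}) := path_length u.
exact: (@Order.TotalTheory.bigmin_le_cond _ _ _ _ t _ len Ps).
Qed.

(** The path [s] forces the distance below [#|T|], so the iterated minimum is not its default value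
    and is reached at some path. *)
Lemma dist_attained s : is_path G x y s ->
  exists2 t, is_path G x y t & path_length t = dist G x y.
Proof.
move=> Ps; have : dist G x y < #|T|.
  apply: leq_ltn_trans (dist_le Ps) _.
  by have /andP[s_gt0] := is_path_size Ps; rewrite /path_length prednK.
rewrite /dist; elim/big_rec: _ => [|t d Pt IH]; first by rewrite ltnn.
rewrite /minn; case: ifP => [_ _|_ /IH//]; by exists t.
Qed.

(** Trades [dist] for a comparison of sizes; paths are nonempty, so the truncated predecessor in
    [path_length] does no harm. *)
Lemma shortest_pathP s : reflect
  (is_path G x y s /\ forall t, is_path G x y t -> size s <= size t)
  (shortest_path G x y s).
Proof.
apply: (iffP andP) => [[Ps /eqP ds]|[Ps min_s]]; split=> //.
  move=> t Pt; have := dist_le Pt; rewrite -ds /path_length.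
  have /andP[s_gt0 _] := is_path_size Ps.
  by have /andP[t_gt0 _] := is_path_size Pt; rewrite -ltnS !prednK.
rewrite eqn_leq dist_le // andbT.
by have [t Pt <-] := dist_attained Ps; rewrite /path_length -!subn1 leq_sub2r ?min_s.
Qed.

Lemma shortest_path_size s t :
  shortest_path G x y s -> shortest_path G x y t -> size s = size t.
Proof.
move=> /shortest_pathP[Ps min_s] /shortest_pathP[Pt min_t].
by apply/eqP; rewrite eqn_leq min_s ?min_t.
Qed.

End Paths.

(** * Cutting and joining paths at the cut vertex *)

Section OneSum.
Variables (T : finType) (G1 G2 : sgraph T) (a b c : T).
Hypothesis hc : verts G1 :&: verts G2 = [set c].
Hypothesis ha : a \in verts G1 :\ c.
Hypothesis hb : b \in verts G2 :\ c.
Implicit Types s t p q : seq T.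

Local Notation G := (graph_union G1 G2).

Lemma cut_vertex x : x \in verts G1 -> x \in verts G2 -> x = c.
Proof. by move=> V1x V2x; apply/set1P; rewrite -hc inE V1x. Qed.

(** An edge of [G2] leaving a vertex of [G1] would force that vertex to be [c]. Only [belast x p]
    must avoid [c], so the walk may end there. *)
Lemma union_path_prefix x p : x \in verts G1 -> c \notin belast x p ->
  path (adj G) x p -> path (adj G1) x p.
Proof.
elim: p x => //= y p IHp x V1x; rewrite inE negb_or => /andP[c'x c'p].
have c_x : x \in verts G2 -> False.
  by move=> /(cut_vertex V1x) xc; rewrite xc eqxx in c'x.
case/andP=> /orP[xy|/adj_verts/c_x//] yp; rewrite xy IHp //.
by apply: (@adj_verts _ G1 y x); rewrite adj_sym.
Qed.

(** Membership in [G2] propagates backwards from the last vertex: an edge of [G1] entering a vertex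
    of [G2] would enter [c]. The start [x] may itself be [c]. *)
Lemma union_path_suffix x p : last x p \in verts G2 -> c \notin p ->
  path (adj G) x p -> path (adj G2) x p.
Proof.
elim: p x => //= y p IHp x V2l; rewrite inE negb_or => /andP[c'y c'p].
case/andP=> xy /(IHp _ V2l c'p) yp; rewrite yp andbT.
(* Either [y] is the last vertex, or it starts an edge already known to lie in [G2]. *)
have V2y : y \in verts G2.
  by case: p V2l yp {IHp c'p} => //= z p _ /andP[/adj_verts].
case/orP: xy => //; rewrite adj_sym => /adj_verts/cut_vertex/(_ V2y) yc.
by rewrite yc eqxx in c'y.
Qed.

Lemma union_path_split s : is_path G a b s ->
  exists p q, [/\ s = (a :: p) ++ q, is_path G1 a c (a :: p)
                & is_path G2 c b (c :: q)].
Proof.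
have [[a'c V1a] [b'c V2b]] := (setD1P ha, setD1P hb).
case/is_pathP=> r -> [_ ar rb ur].
(* Avoiding [c], the whole path would stay in [G1], so [b] would be a common vertex and hence equal
   to [c]. *)
have cr : c \in r.
  apply: contraNT b'c => c'r; apply/eqP/cut_vertex => //.
  have ar1 : path (adj G1) a r.
    apply: union_path_prefix => //.
    apply: contra c'r => /mem_belast; rewrite inE => /predU1P[ca|//].
    by rewrite ca eqxx in a'c.
  by apply: (path_verts V1a ar1); rewrite -rb mem_last.
have V1c : c \in verts G1 by have := set11 c; rewrite -hc => /setIP[].
have V2c : c \in verts G2 by have := set11 c; rewrite -hc => /setIP[].
case/splitPr: cr ar rb ur => p q; rewrite -cat_rcons cat_path last_cat last_rcons.
case/andP=> ap cq qb; rewrite -cat_cons cat_uniq => /and3P[up /hasPn disj uq].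
have c'q : c \notin q.
  by apply/negP=> /disj; rewrite /= inE mem_rcons mem_head orbT.
exists (rcons p c), q; split=> //; apply/is_pathP.
  exists (rcons p c); split; rewrite ?last_rcons //.
  apply: union_path_prefix => //; rewrite belast_rcons.
  by move: up; rewrite -rcons_cons rcons_uniq => /andP[].
exists q; split=> //=; last by rewrite c'q.
by apply: union_path_suffix; rewrite ?qb.
Qed.

(** [behead] removes the second copy of [c]. A repeated vertex would lie in both graphs, hence be
    [c], which does not recur in the tail of [t]. *)
Lemma union_path_join s t : is_path G1 a c s -> is_path G2 c b t ->
  is_path G a b (s ++ behead t).
Proof.
case/is_pathP=> p -> [V1a ap pc up] /is_pathP[q -> [V2c cq qb]].
rewrite cons_uniq => /andP[c'q uq]; apply/is_pathP; exists (p ++ q); split=> //.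
- by rewrite inE V1a.
- rewrite cat_path pc; apply/andP; split.
    by apply: sub_path ap => x y xy; rewrite /= /union_adj xy.
  by apply: sub_path cq => x y xy; rewrite /= /union_adj xy orbT.
- by rewrite last_cat pc.
rewrite -cat_cons cat_uniq up uq andbT; apply/hasPn=> x qx; apply/negP=> px.
have xc : x = c.
  apply: cut_vertex; first exact: (path_verts V1a ap).
  by apply: (path_verts V2c cq); rewrite inE qx orbT.
by rewrite -xc qx in c'q.
Qed.

Lemma size_join s t : is_path G2 c b t ->
  size (s ++ behead t) = (size s + size t).-1.
Proof. by case/is_pathP=> q -> _; rewrite size_cat addnS. Qed.

Lemma shortest_join s t : is_path G1 a c s -> is_path G2 c b t ->
  shortest_path G a b (s ++ behead t)
    = shortest_path G1 a c s && shortest_path G2 c b t.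
Proof.
move=> Ps Pt; apply/shortest_pathP/andP => [[_ min_st]|].
  (* Exchange one piece for a competitor [r], keep the other, and cancel the common size. *)
  split; apply/shortest_pathP; split=> // r Pr.
    have := min_st _ (union_path_join Pr Pt).
    by rewrite !size_cat leq_add2r.
  have := min_st _ (union_path_join Ps Pr).
  case/is_pathP: Pr Pt => r' -> _ /is_pathP[t' -> _].
  by rewrite !size_cat leq_add2l.
case=> /shortest_pathP[_ min_s] /shortest_pathP[_ min_t].
split; first exact: union_path_join.
move=> r /union_path_split[p [q [-> Pp Pq]]].
rewrite size_join // -[q]/(behead (c :: q)) size_join //.
by rewrite -!subn1 leq_sub2r // leq_add ?min_s ?min_t.
Qed.

Lemma diff_count_join s s' t t' :
    shortest_path G1 a c s -> shortest_path G1 a c s' ->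
    shortest_path G2 c b t -> shortest_path G2 c b t' ->
  (diff_count (s ++ behead t) (s' ++ behead t') == 1)
    = (s == s') && (diff_count t t' == 1) || (diff_count s s' == 1) && (t == t').
Proof.
move=> Ss Ss' St St'; rewrite diff_count_cat; last exact: shortest_path_size Ss'.
rewrite -(diff_count_eq0 (shortest_path_size Ss Ss')).
rewrite -(diff_count_eq0 (shortest_path_size St St')).
(* Both right pieces start with [c], so dropping this head loses no disagreement. *)
case/shortest_pathP: St St' => /is_pathP[q -> _] _ /shortest_pathP[].
case/is_pathP=> q' -> _ _; rewrite /= /(diff_count (c :: q)) /= eqxx add0n.
rewrite -/(diff_count q q').
by case: (diff_count s s') (diff_count q q') => [|[|m]] [|[|n]].
Qed.

(** An explicit inverse to joining, needed to define a map; [c] is kept in both pieces. *)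
Definition cut_left s := take (index c s).+1 s.
Definition cut_right s := drop (index c s) s.

Lemma cut_join s t : is_path G1 a c s -> is_path G2 c b t ->
  cut_left (s ++ behead t) = s /\ cut_right (s ++ behead t) = t.
Proof.
case/is_pathP=> p -> [_ _ pc up] /is_pathP[q -> _].
(* [c] ends the duplicate-free list [a :: p], so its first occurrence is at position [size p]. *)
have idx : index c ((a :: p) ++ q) = size p.
  by rewrite index_cat -pc mem_last index_last.
rewrite /cut_left /cut_right idx; split; first exact: take_size_cat.
by rewrite lastI pc cat_rcons drop_size_cat // size_belast.
Qed.

Lemma shortest_cut s : shortest_path G a b s ->
  [/\ shortest_path G1 a c (cut_left s), shortest_path G2 c b (cut_right s)
    & cut_left s ++ behead (cut_right s) = s].
Proof.
move=> Ss; have [Ps _] := andP Ss.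
have [p [q [def_s Pp Pq]]] := union_path_split Ps.
rewrite {}def_s -[q]/(behead (c :: q)) in Ss *.
have [-> ->] := cut_join Pp Pq.
by move: Ss; rewrite shortest_join // => /andP[].
Qed.

End OneSum.

Section BoundedShortestPaths.
Variables (T : finType) (H : sgraph T) (x y : T).

Lemma mem_sp_verts (s : {bseq #|T| of T}) :
  (s \in verts (shortest_path_graph H x y)) = shortest_path H x y s.
Proof. by rewrite inE. Qed.

Lemma sp_adjE (s t : {bseq #|T| of T}) :
  shortest_path H x y s -> shortest_path H x y t ->
  sp_adj H x y s t = (diff_count s t == 1).
Proof. by move=> Ss St; rewrite /sp_adj !mem_sp_verts Ss St. Qed.

(** [insub_bseq] returns a default on lists longer than the bound; a path repeats no vertex, so it
    fits. *)
Lemma insub_shortest s : shortest_path H x y s ->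
  insub_bseq #|T| s = s :> seq T.
Proof.
case/andP=> /is_path_size/andP[_ szs] _.
by rewrite /insub_bseq insubdK.
Qed.

End BoundedShortestPaths.

Theorem theorem10 (T : finType) (G1 G2 : sgraph T) (c : T)
    (hc : verts G1 :&: verts G2 = [set c]) (a b : T)
    (ha : a \in verts G1 :\ c) (hb : b \in verts G2 :\ c) :
  graph_iso (shortest_path_graph (graph_union G1 G2) a b)
            (cartesian_product (shortest_path_graph G1 a c)
                               (shortest_path_graph G2 c b)).
Proof.
set S := shortest_path_graph _ a b; set P := cartesian_product _ _.
(* [F] cuts at [c] and [J] joins; they are total on bounded sequences and meaningful only on
   vertices of the two graphs. *)
pose F (u : {bseq #|T| of T}) :=
  (insub_bseq #|T| (cut_left c u), insub_bseq #|T| (cut_right c u)).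
pose J (w : {bseq #|T| of T} * {bseq #|T| of T}) :=
  insub_bseq #|T| (w.1 ++ behead w.2).
have valF u : u \in verts S -> [/\ shortest_path G1 a c (F u).1,
    shortest_path G2 c b (F u).2 & (F u).1 ++ behead (F u).2 = u :> seq T].
  rewrite mem_sp_verts => /(shortest_cut hc ha hb)[Sl Sr joinK].
  by rewrite /F (insub_shortest Sl) (insub_shortest Sr).
have memP w : (w \in verts P)
    = shortest_path G1 a c w.1 && shortest_path G2 c b w.2.
  by case: w => w1 w2; apply: etrans (in_setX _ _ _ _) _; rewrite !mem_sp_verts.
have FP u : u \in verts S -> F u \in verts P by rewrite memP => /valF[-> ->].
have valJ w : w \in verts P -> shortest_path (graph_union G1 G2) a b (J w)
    /\ J w = w.1 ++ behead w.2 :> seq T.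
  rewrite memP => Pw; have [/andP[P1 _] /andP[P2 _]] := andP Pw.
  have Sj := etrans (shortest_join hc ha hb P1 P2) Pw.
  by rewrite /J (insub_shortest Sj).
have JS w : w \in verts P -> J w \in verts S by rewrite mem_sp_verts => /valJ[].
exists (fun u => Sub (F (val u)) (FP _ (valP u))); split.
  (* [J] after [F] is the identity by [shortest_cut], [F] after [J] by [cut_join]. *)
  exists (fun w => Sub (J (val w)) (JS _ (valP w))) => [[u Su]|[w Pw]].
    apply/val_inj/val_inj; rewrite /=.
    by have [_ ->] := valJ _ (FP _ Su); have [] := valF _ Su.
  apply/val_inj => /=; have [_ Jw] := valJ _ Pw.
  have /andP[S1 S2] := etrans (esym (memP w)) Pw.
  have [[P1 _] [P2 _]] := (andP S1, andP S2).
  have [Fl Fr] := cut_join P1 P2; rewrite /F Jw Fl Fr.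
  by rewrite /insub_bseq !valKd; case: (w).
move=> [u Su] [v Sv] /=; rewrite /cart_adj /sp_adj.
have [S1 S2 Fu] := valF _ Su; have [S1' S2' Fv] := valF _ Sv.
rewrite -[cart_verts _ _]/(verts P) -/(sp_verts _ a b) Su Sv !FP //=.
(* Writing both paths as joins of their pieces reduces adjacency to [diff_count_join]. *)
have -> : diff_count u v
  = diff_count ((F u).1 ++ behead (F u).2) ((F v).1 ++ behead (F v).2).
  by rewrite Fu Fv.
by rewrite (diff_count_join S1 S1' S2 S2') (sp_adjE S1 S1') (sp_adjE S2 S2').
Qed.
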